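(* Let $G$ be a countable metabelian group. Then for any character $\varphi$ of $G$ there is a normal subgroup $H\lhd G$ such that $\varphi$ is induced from the abelianization $H^{\mathrm{ab}}=H/[H,H]$.
   Context: A trace on a discrete group $G$ is a positive-definite, conjugation-invariant function $\varphi:G\to\mathbb{C}$ with $\varphi(e)=1$. A character of $G$ is a trace that is not a proper convex combination of traces (an extreme point of the convex set of traces). Induction: write $g^h=h^{-1}gh$. For a subgroup $H\le G$, a function $\varphi$ on $H$ and $g\in G$ normalizing $H$, put $\varphi^g(h)=\varphi(g^{-1}hg)$ (same formula for functions on $G$). A trace $\varphi$ on $H$ is almost $G$-invariant if $G_\varphi=\{g\in \mathrm{N}_G(H):\varphi^g=\varphi\}$ has finite index in $G$. Let $\widetilde\varphi:G\to\mathbb{C}$ be the extension of $\varphi$ by $0$ outside $H$. The induced trace is $\mathrm{Ind}^G_H\varphi=\frac{1}{[G:G_\varphi]}\sum_{g\in G/G_\varphi}\widetilde{\varphi}^{\,g}$, a trace on $G$. (If $H$ is normal and $\varphi$ is $G$-invariant, then $\mathrm{Ind}^G_H\varphi=\widetilde\varphi$.) Let $L\lhd K\le G$. A trace $\varphi$ on $G$ is induced from the subquotient $K/L$ if there is a trace on $K/L$ whose pullback $\psi$ to $K$ is almost $G$-invariant and satisfies $\varphi=\mathrm{Ind}^G_K\psi$. ''Induced from $H^{\mathrm{ab}}$'' refers to the subquotient $H/[H,H]$. *)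

(* Defs.v *)
From HB Require Import structures.
From mathcomp Require Import all_boot all_order all_algebra.
From mathcomp Require Import finmap.
From mathcomp Require Import boolp classical_sets cardinality fsbigop reals.
From mathcomp Require Import complex.
Set Implicit Arguments.
Unset Strict Implicit.
Unset Printing Implicit Defensive.
Import Order.TTheory GRing.Theory Num.Theory.

Local Open Scope ring_scope.
Local Open Scope group_scope.
Local Open Scope quotient_scope.

(** Subgroups of a (possibly infinite) group [G] are the inhabitants of the
    library type [groupClosed G].  They are boolean predicates, which is
    classically no restriction: [`[< P >]] decides any [P : Prop]. *)

HB.mixin Record isConjClosed (G : groupType) (S : {pred G}) := {
  gpred_conj : forall x y : G, x \in S -> x ^ y \in S
}.

#[short(type="normalClosed")]
HB.structure Definition NormalClosed (G : groupType) :=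
  {S of isConjClosed G S & GroupClosed G S}.

Section SubgroupType.
Variables (G : groupType) (S : groupClosed G).

Record subgroup_type := SubgroupElt { sgval : G; sgvalP : sgval \in S }.

HB.instance Definition _ := [isSub for sgval].
HB.instance Definition _ := [Choice of subgroup_type by <:].

Fact subgroup_type_closed : group_closed (fun x : G => x \in S).
Proof. by split; [exact: gpred1 | exact: gpredF]. Qed.

HB.instance Definition _ :=
  SubChoice_isSubGroup.Build G _ subgroup_type subgroup_type_closed.

End SubgroupType.

Section LeftCosets.
Variables (G : groupType) (S : groupClosed G).

Definition lcoset_rel : rel G := fun x y => x^-1 * y \in S.

Fact lcoset_rel_refl : reflexive lcoset_rel.
Proof. by move=> x; rewrite /lcoset_rel mulVg gpred1. Qed.

Fact lcoset_rel_sym : symmetric lcoset_rel.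
Proof. by move=> x y; rewrite /lcoset_rel -gpredV invgM invgK. Qed.

Fact lcoset_rel_trans : transitive lcoset_rel.
Proof. by move=> y x z xy yz; have:= gpredM _ _ xy yz; rewrite mulgA mulgK. Qed.

Canonical lcoset_equiv :=
  EquivRel lcoset_rel lcoset_rel_refl lcoset_rel_sym lcoset_rel_trans.

Definition lcosets := {eq_quot lcoset_equiv}.

HB.instance Definition _ := Choice.on lcosets.
HB.instance Definition _ := EqQuotient.on lcosets.

Lemma pi_lcosetP x y : reflect (\pi_lcosets x = \pi_lcosets y) (x^-1 * y \in S).
Proof. exact: eqmodP. Qed.

Definition finite_index : Prop := finite_set [set: lcosets].

Definition subgroup_index : nat := #|` fset_set [set: lcosets]|.

End LeftCosets.

Section QuotientGroup.
Variables (G : groupType) (N : normalClosed G).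

Definition quotient_group := lcosets N.

HB.instance Definition _ := Choice.on quotient_group.
HB.instance Definition _ := EqQuotient.on quotient_group.

Definition quot_one : quotient_group := \pi_quotient_group 1.
Definition quot_inv (a : quotient_group) : quotient_group := \pi_quotient_group ((repr a)^-1).
Definition quot_mul (a b : quotient_group) : quotient_group :=
  \pi_quotient_group (repr a * repr b).

Fact repr_lcoset x : exists2 n, n \in N & repr (\pi_quotient_group x) = x * n.
Proof.
exists (x^-1 * repr (\pi_quotient_group x)); last by rewrite mulVKg.
by apply/pi_lcosetP; rewrite reprK.
Qed.

Fact quot_piM x y : quot_mul (\pi x) (\pi y) = \pi_quotient_group (x * y).
Proof.
rewrite /quot_mul; have [m Nm ->] := repr_lcoset x.
have [n Nn ->] := repr_lcoset y; apply/esym/pi_lcosetP.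
have -> : (x * y)^-1 * (x * m * (y * n)) = m ^ y * n.
  by rewrite conjgE invgM !mulgA mulgVK.
by apply: gpredM => //; apply: gpred_conj.
Qed.

Fact quot_piV x : quot_inv (\pi x) = \pi_quotient_group (x^-1).
Proof.
rewrite /quot_inv; have [n Nn ->] := repr_lcoset x.
apply/esym/pi_lcosetP; rewrite invgK invgM.
have -> : x * (n^-1 * x^-1) = n^-1 ^ x^-1 by rewrite conjgE invgK.
by apply: gpred_conj; rewrite gpredV.
Qed.

Fact quot_mulA : associative quot_mul.
Proof.
by move=> a b c; rewrite -[a]reprK -[b]reprK -[c]reprK !quot_piM mulgA.
Qed.

Fact quot_mul1 : left_id quot_one quot_mul.
Proof. by move=> a; rewrite -[a]reprK quot_piM mul1g. Qed.

Fact quot_mulr1 : right_id quot_one quot_mul.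
Proof. by move=> a; rewrite -[a]reprK quot_piM mulg1. Qed.

Fact quot_mulV : left_inverse quot_one quot_inv quot_mul.
Proof. by move=> a; rewrite -[a]reprK quot_piV quot_piM mulVg. Qed.

Fact quot_mulrV : right_inverse quot_one quot_inv quot_mul.
Proof. by move=> a; rewrite -[a]reprK quot_piV quot_piM mulgV. Qed.

HB.instance Definition _ := isGroup.Build quotient_group
  quot_mulA quot_mul1 quot_mulr1 quot_mulV quot_mulrV.

End QuotientGroup.

Section Derived.
Variable G : groupType.

Definition derived : {pred G} := fun x =>
  `[< forall S : groupClosed G, (forall a b, [~ a, b] \in S) -> x \in S >].

Fact derivedP x : reflect
  (forall S : groupClosed G, (forall a b, [~ a, b] \in S) -> x \in S)
  (x \in derived).
Proof. exact: asboolP. Qed.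

Fact derived_mul : mulg_closed derived.
Proof.
move=> x y /derivedP Dx /derivedP Dy; apply/derivedP => S SR.
by apply: gpredM; [apply: Dx | apply: Dy].
Qed.

Fact derived_one : 1 \in derived.
Proof. by apply/derivedP => S _; apply: gpred1. Qed.

Fact derived_inv : invg_closed derived.
Proof.
by move=> x /derivedP Dx; apply/derivedP => S SR; apply/gpredVr/Dx.
Qed.

Fact derived_conj x y : x \in derived -> x ^ y \in derived.
Proof.
move=> Dx; have -> : x ^ y = x * [~ x, y] by rewrite commgEl mulVKg.
by apply: derived_mul => //; apply/derivedP.
Qed.

HB.instance Definition _ := isMulClosed.Build G derived derived_mul.
HB.instance Definition _ := isMul1Closed.Build G derived derived_one.
HB.instance Definition _ := isInvClosed.Build G derived derived_inv.
HB.instance Definition _ := isConjClosed.Build G derived derived_conj.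

Definition metabelian : Prop := {in derived &, forall x y, commute x y}.

End Derived.

Section Traces.
Variable R : realType.
Local Notation C := R[i].

(** In the partial order of [R[i]], [0 <= z] means that [z] is a nonnegative
    real. *)
Definition positive_definite (G : groupType) (phi : G -> C) : Prop :=
  forall (n : nat) (c : 'I_n -> C) (g : 'I_n -> G),
    (0 <= \sum_(i < n) \sum_(j < n)
            ((c i)^*)%C * c j * phi ((g i)^-1 * g j)%g)%R.

Definition conj_invariant (G : groupType) (phi : G -> C) : Prop :=
  forall g h : G, phi (h ^ g) = phi h.

Definition is_trace (G : groupType) (phi : G -> C) : Prop :=
  [/\ positive_definite phi, conj_invariant phi & phi 1%g = 1%R].

Definition is_character (G : groupType) (phi : G -> C) : Prop :=
  is_trace phi /\
  forall (phi1 phi2 : G -> C) (t : R),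
    is_trace phi1 -> is_trace phi2 -> (0 < t < 1)%R ->
    (forall g, phi g = t%:C%C * phi1 g + (1 - t)%:C%C * phi2 g)%R ->
    phi1 =1 phi /\ phi2 =1 phi.

Section Induction.
Variables (G : groupType) (K : groupClosed G) (psi : subgroup_type K -> C).

Definition zero_ext (x : G) : C := oapp psi 0%R (insub x).

Definition normalises (g : G) : Prop := forall x : G, (x ^ g \in K) = (x \in K).

(** For [g] normalising [K], [zero_ext (val h ^ g)] is the value
    [psi^g(h) = psi(g^-1 h g)]. *)
Definition stabiliser : {pred G} := fun g =>
  `[< normalises g /\
      forall h : subgroup_type K, zero_ext (val h ^ g) = psi h >].

Fact zero_ext_val (h : subgroup_type K) : zero_ext (val h) = psi h.
Proof. by rewrite /zero_ext valK. Qed.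

Fact zero_ext_out x : x \notin K -> zero_ext x = 0%R.
Proof. by move=> Kx; rewrite /zero_ext insubN. Qed.

Fact stabiliserP g : reflect
  (normalises g /\ forall x : G, zero_ext (x ^ g) = zero_ext x)
  (g \in stabiliser).
Proof.
apply: (iffP (asboolP _)) => -[nKg psig]; split=> //; last first.
  by move=> h; rewrite psig zero_ext_val.
move=> x; have [Kx|Kx] := boolP (x \in K); last first.
  by rewrite !zero_ext_out ?nKg.
by rewrite -[x]/(val (SubgroupElt Kx)) psig zero_ext_val.
Qed.

Fact stabiliser_mul : mulg_closed stabiliser.
Proof.
move=> x y /stabiliserP[nKx psix] /stabiliserP[nKy psiy]; apply/stabiliserP.
by split=> z; rewrite conjgM ?nKy ?nKx ?psiy ?psix.
Qed.

Fact stabiliser_one : 1%g \in stabiliser.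
Proof. by apply/stabiliserP; split=> z; rewrite conjg1. Qed.

Fact stabiliser_inv : invg_closed stabiliser.
Proof.
move=> x /stabiliserP[nKx psix]; apply/stabiliserP; split=> z.
  by rewrite -[LHS]nKx conjgKV.
by rewrite -[LHS]psix conjgKV.
Qed.

HB.instance Definition _ := isMulClosed.Build G stabiliser stabiliser_mul.
HB.instance Definition _ := isMul1Closed.Build G stabiliser stabiliser_one.
HB.instance Definition _ := isInvClosed.Build G stabiliser stabiliser_inv.

Definition almost_invariant : Prop := finite_index stabiliser.

(** By [zero_ext_repr] below, the summand only depends on the coset [a].
    Meaningful only if [almost_invariant]. *)
Definition Ind (x : G) : C :=
  ((subgroup_index stabiliser)%:R^-1 *
   \sum_(a \in [set: lcosets stabiliser]) zero_ext (x ^ repr a)%g)%R.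

Lemma zero_ext_repr (g x : G) :
  zero_ext (x ^ repr (\pi_(lcosets stabiliser) g)) = zero_ext (x ^ g).
Proof.
set r := repr _.
have /stabiliserP[_ psir] : g^-1 * r \in stabiliser.
  by apply/pi_lcosetP; rewrite reprK.
by rewrite -[r in LHS](mulVKg g) conjgM psir.
Qed.

End Induction.

(** [phi] is induced from the subquotient [K / L] of [G], where [L] is normal
    in [K]. *)
Definition induced_from_subquotient (G : groupType) (K : groupClosed G)
    (L : normalClosed (subgroup_type K)) (phi : G -> C) : Prop :=
  exists chi : quotient_group L -> C,
    let psi := fun k : subgroup_type K => chi (\pi_(quotient_group L) k) in
    [/\ is_trace chi, almost_invariant psi & phi =1 Ind psi].

Definition induced_from_abelianization (G : groupType) (H : groupClosed G)
    (phi : G -> C) : Prop :=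
  @induced_from_subquotient G H (@derived (subgroup_type H)) phi.

End Traces.

(* Main.v *)
From HB Require Import structures.
Require Import Defs.
From mathcomp Require Import all_boot all_order all_algebra.
From mathcomp Require Import finmap.
From mathcomp Require Import boolp classical_sets cardinality fsbigop reals.
From mathcomp Require Import complex.
From mathcomp Require Import topology normedtype.
From mathcomp Require Import ring.
Set Implicit Arguments.
Unset Strict Implicit.
Unset Printing Implicit Defensive.

(** Let [A] be the derived subgroup of [G], abelian because [G] is metabelian,
    and call [{x | phi x = 1}] the kernel of the character [phi]; it is a normal
    subgroup and [phi] is constant on its cosets.

    The engine is [character_periods]: if [N] is an abelian normal subgroup and
    [phi] takes a constant non-zero value on some coset [g N], then [N] lies in
    the kernel.  In the GNS representation of [phi], with cyclic vector [xi],
    let [p] be the projection onto the [N]-invariant vectors.  It commutes with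
    [G] because [N] is normal, so [psi x = <xi, p x xi>] is a conjugation
    invariant positive definite function, as is [phi - psi]; extremality of
    [phi] then forces [psi = psi 1 * phi] ([character_dominated]).  Constancy
    on [g N] gives [psi g = phi g], which is non-zero, hence [psi 1 = 1] and
    [psi = phi].  As [psi] is [N]-invariant, [phi = 1] on [N].

    No Hilbert space is built.  A vector state is replaced by its kernel
    [K x y = phi (x^-1 y)], and [p] by the averages [(1 + n) / 2] with [n] in
    [N] applied to both arguments of [K].  Since [N] is abelian these commute,
    so their finite products form a net, and each step decreases the kernel
    in the positive semidefinite order: the net converges pointwise
    ([avg_limit]), and [invariant_part] collects the properties of the limit.

    To apply this, consider for [g] in the support of [phi] the elements [n] of
    [A] such that right translation by [n] leaves [phi] unchanged on the coset
    [g A].  They form a normal subgroup of [G], which therefore lies in the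
    kernel ([derived_period_ker]).  It contains [[g, a]] for [a] in [A], since
    conjugation by [a] preserves [phi]; once these commutators are known to lie
    in the kernel, it also contains [[g, k]] for every [k] in the support.  So
    the support of [phi] commutes with itself modulo the kernel
    ([support_commg_ker]), and so does the bicommutant [H] of the support modulo
    the kernel, which is a normal subgroup.  Outside [H] the character vanishes
    and on [H] it factors through the abelianization; being invariant under
    conjugation, it is its own induction from [H]. *)

Import Order.TTheory GRing.Theory Num.Theory.
Import numFieldNormedType.Exports.
Local Open Scope classical_set_scope.
Local Open Scope ring_scope.
Local Open Scope quotient_scope.

(** * Positive semidefinite kernels *)

Section PsdKernels.
Variables (C : numClosedFieldType) (T : Type).
Implicit Types (K : T -> T -> C) (x y z : T) (c d s : C).

(** Arbitrary finite index types, rather than ordinals, let [psd_comb] use a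
    product as the index set. *)
Definition psd K := forall (I : finType) (a : I -> C) (g : I -> T),
  0 <= \sum_i \sum_j (a i)^* * a j * K (g i) (g j).

Lemma psdD K1 K2 : psd K1 -> psd K2 -> psd (fun x y => K1 x y + K2 x y).
Proof.
move=> P1 P2 I a g; have := addr_ge0 (P1 I a g) (P2 I a g).
rewrite -big_split /=; congr (_ <= _); apply: eq_bigr => i _.
by rewrite -big_split /=; apply: eq_bigr => j _; rewrite mulrDr.
Qed.

Lemma psdZ t K : 0 <= t -> psd K -> psd (fun x y => t * K x y).
Proof.
move=> t0 PK I a g; have := mulr_ge0 t0 (PK I a g).
rewrite mulr_sumr; congr (_ <= _); apply: eq_bigr => i _.
by rewrite mulr_sumr; apply: eq_bigr => j _; ring.
Qed.

(** The new form at the vector [sum a_i g_i] is the old one at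
    [sum a_i w_l (f_l g_i)]. *)
Lemma psd_comb (L : finType) (w : L -> C) (f : L -> T -> T) K : psd K ->
  psd (fun x y => \sum_l \sum_m (w l)^* * w m * K (f l x) (f m y)).
Proof.
move=> PK I a g.
have := PK (I * L)%type (fun p => a p.1 * w p.2) (fun p => f p.2 (g p.1)).
congr (_ <= _).
rewrite -(pair_bigA _ (fun i l => \sum_(q : I * L)
  (a i * w l)^* * (a q.1 * w q.2) * K (f l (g i)) (f q.2 (g q.1)))) /=.
apply: eq_bigr => i _.
under eq_bigr => l _ do rewrite -(pair_bigA _ (fun j m =>
  (a i * w l)^* * (a j * w m) * K (f l (g i)) (f m (g j)))) /=.
rewrite exchange_big /=; apply: eq_bigr => j _; rewrite mulr_sumr.
apply: eq_bigr => l _; rewrite mulr_sumr; apply: eq_bigr => m _.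
by rewrite rmorphM /=; ring.
Qed.

Lemma psd_form3 K s c d z x y : psd K ->
  0 <= s^* * s * K z z + c^* * c * K x x + d^* * d * K y y
     + s^* * c * K z x + c^* * s * K x z + s^* * d * K z y + d^* * s * K y z
     + c^* * d * K x y + d^* * c * K y x.
Proof.
move=> /(_ 'I_3 (fun i => nth 0 [:: s; c; d] i) (fun i => nth z [:: z; x; y] i)).
by rewrite !big_ord_recl !big_ord0 /=; congr (_ <= _); ring.
Qed.

Lemma psd_form2 K c d x y : psd K ->
  0 <= c^* * c * K x x + d^* * d * K y y + c^* * d * K x y + d^* * c * K y x.
Proof.
by move=> /(psd_form3 0 c d x x y); rewrite rmorph0; congr (_ <= _); ring.
Qed.

Lemma psd_diag_ge0 K x : psd K -> 0 <= K x x.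
Proof.
move=> /(psd_form2 1 0 x x); rewrite rmorph0 rmorph1.
by congr (_ <= _); ring.
Qed.

Lemma psd_hermitian K x y : psd K -> K y x = (K x y)^*.
Proof.
move=> PK; have /geC0_conj := psd_form2 1 1 x y PK.
have /geC0_conj := psd_form2 1 'i x y PK.
have /geC0_conj Kx := psd_diag_ge0 x PK; have /geC0_conj Ky := psd_diag_ge0 y PK.
rewrite !rmorphD !rmorphM /= !conjCK !rmorph1 !conjCi Kx Ky => e1 e2.
have {e1} e1 : 'i * ((K x y)^* - (K y x)^*) = 'i * (K y x - K x y).
  by apply: subr0_eq; move/eqP: e1; rewrite -subr_eq0 -oppr_eq0 => /eqP <-; ring.
have {}e1 := mulfI (neq0Ci C) e1.
apply: (mulfI (x := 2)); first by rewrite pnatr_eq0.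
have {}e2 : (K x y)^* + (K y x)^* = K x y + K y x.
  apply: subr0_eq; move/eqP: e2; rewrite -subr_eq0 => /eqP <-; ring.
transitivity (K x y + K y x + (K y x - K x y)); first by ring.
by rewrite -e1 -e2; ring.
Qed.

(** Cauchy-Schwarz in the degenerate case: a vector [v = c x + d y] of norm
    zero is orthogonal to every [z]. With [w = <z, v>], the squared norm of
    [v - e w z] equals [|w| ^ 2 (e ^ 2 |z| ^ 2 - 2 e)], and it is negative for
    small [e > 0] unless [w = 0]. *)
Lemma psd_null K c d x y z : psd K ->
    c^* * c * K x x + d^* * d * K y y + c^* * d * K x y + d^* * c * K y x = 0 ->
  c * K z x + d * K z y = 0.
Proof.
move=> PK null; set w := c * K z x + d * K z y.
have P0 := psd_diag_ge0 z PK.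
have wE : w^* = c^* * K x z + d^* * K y z.
  by rewrite rmorphD !rmorphM /= -!(psd_hermitian _ _ PK).
(* This choice makes [e * K z z < 1]. *)
set e := (K z z + 1)^-1.
have P1 : 0 < K z z + 1 by rewrite ltr_wpDl.
have e0 : 0 < e by rewrite invr_gt0.
have eP : e * K z z < 1 by rewrite mulrC ltr_pdivrMr // mul1r ltrDl.
have sE : (- e * w)^* = - e * w^*.
  by rewrite rmorphM rmorphN; congr (- _ * _); apply/geC0_conj/ltW.
have := psd_form3 (- e * w) c d z x y PK; rewrite sE.
set S := (X in 0 <= X -> _).
have -> : S = (e * (e * K z z - 2)) * `|w| ^+ 2.
  rewrite normCK /S.
  transitivity (e ^+ 2 * K z z * (w * w^*) - e * (w^* * (c * K z x + d * K z y))
     - e * (w * (c^* * K x z + d^* * K y z))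
     + (c^* * c * K x x + d^* * d * K y y + c^* * d * K x y + d^* * c * K y x)).
    by move: (w) (w^*) => u v; ring.
  by rewrite null -wE -/w; ring.
have lt0 : (e * (e * K z z - 2)) < 0.
  rewrite pmulr_rlt0 // subr_lt0 (lt_trans eP) //.
  by rewrite ltr1n.
rewrite nmulr_rge0 // => w0.
have : `|w| ^+ 2 == 0 by rewrite eq_le w0 exprn_ge0.
by rewrite expf_eq0 /= normr_eq0 => /eqP.
Qed.

Lemma psd_diag0 K x z : psd K -> K x x = 0 -> K z x = 0.
Proof.
move=> PK Kx; have := @psd_null K 1 0 x x z PK.
by rewrite Kx !rmorph0 !(mul0r, mulr0, addr0, mul1r); apply.
Qed.

(** The four values [q d] are the squared norms of [x + d y] for [d] a fourth
    root of unity. *)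
Lemma psd_polarization K x y :
  let q d := 1^* * 1 * K x x + d^* * d * K y y + 1^* * d * K x y + d^* * 1 * K y x in
  K x y = 4^-1 * (q 1 - q (- 1) - 'i * q 'i + 'i * q (- 'i)).
Proof.
rewrite /= !rmorphN !rmorph1 /= !conjCi.
transitivity (4^-1 * (2 * (K x y + K y x) - 2 * 'i ^+ 2 * (K x y - K y x))).
  by rewrite sqrCi; field.
by ring.
Qed.

End PsdKernels.

(** * Limits of decreasing nets *)

(** Decreasing nets of non-negative numbers converge, the net being a function
    that is eventually below each of the values it takes on a member of the
    filter. Convergence is spelled out with epsilons, so that the property
    speaks of the ordered field alone. *)
Definition order_complete (C : numClosedFieldType) :=
  forall (X : Type) (F : set_system X), ProperFilter F ->
  forall (S : set X) (u : X -> C), F S ->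
    (forall i, S i -> 0 <= u i) ->
    (forall i, S i -> \forall j \near F, u j <= u i) ->
  exists l, forall e, 0 < e -> \forall j \near F, `|l - u j| < e.

Lemma order_complete_complex (R : realType) : order_complete R[i].
Proof.
move=> X F FF S u FS u0 ule; pose A := [set complex.Re (u i) | i in S].
have uE i : S i -> u i = (complex.Re (u i))%:C%C.
  by move=> /u0 /ger0_Im; case: (u i) => a b /= ->.
have A0 : lbound A 0.
  by move=> _ [i /[dup] Si /uE + <-]; move/u0: Si => /[swap] ->; rewrite ler0c.
have hA : has_inf A.
  split; last by exists 0.
  by have [i Si] := filter_ex FS; exists (complex.Re (u i)); exists i.
exists (inf A)%:C%C => e e0.
have eE : e = (complex.Re e)%:C%C.
  by move/ltW/ger0_Im: e0; case: (e) => a b /= ->.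
have er0 : 0 < complex.Re e by move: e0; rewrite eE -[0]/(0%:C%C) ltcR.
have [_ [i Si <-] lti] := inf_adherent er0 hA.
near=> j.
have Sj : S j by near: j.
have uji : u j <= u i by near: j; apply: ule.
move: uji; rewrite (uE _ Si) (uE _ Sj) lecR => uji.
have lej : inf A <= complex.Re (u j) by apply: ge_inf; [case: hA | exists j].
rewrite -rmorphB /= eE normc_def /= expr0n addr0 sqrtr_sqr ltcR distrC.
by rewrite ger0_norm ?subr_ge0 // ltrBlDl (le_lt_trans uji).
Unshelve. all: by end_near.
Qed.

(** In a partially ordered field, the non-negative numbers are the fixed points
    of the norm, which is continuous. *)
Lemma lim_ge0 (C : numFieldType) (X : Type) (F : set_system X)
    (FF : ProperFilter F) (u : X -> C) l : u @ F --> l ->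
  (\forall i \near F, 0 <= u i) -> 0 <= l.
Proof.
move=> ul u0; suff -> : l = `|l| by [].
apply: (@cvg_unique _ (@norm_hausdorff _ _) (u @ F)) => //.
apply: cvg_trans (cvg_norm ul).
apply: near_eq_cvg; near=> i; rewrite ger0_norm //; near: i; exact: u0.
Unshelve. all: by end_near.
Qed.

Lemma cvg_bigsum (C : numFieldType) (X : Type) (F : set_system X)
    (FF : ProperFilter F) (I : Type) (r : seq I) (f : I -> X -> C) (l : I -> C) :
  (forall i, f i @ F --> l i) ->
  (fun J => \sum_(i <- r) f i J) @ F --> \sum_(i <- r) l i.
Proof.
move=> fl; elim: r => [|i r IHr].
  by under eq_fun do rewrite big_nil; rewrite big_nil; apply: cvg_cst.
under eq_fun do rewrite big_cons; rewrite big_cons.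
exact: cvgD.
Qed.

Lemma psd_lim (C : numClosedFieldType) (T X : Type) (F : set_system X)
    (FF : ProperFilter F) (J : X -> T -> T -> C) (L : T -> T -> C) :
  (forall x y, J i x y @[i --> F] --> L x y) ->
  (\forall i \near F, psd (J i)) -> psd L.
Proof.
move=> JL PJ I a g.
apply: (@lim_ge0 C X F FF
  (fun i => \sum_k \sum_l (a k)^* * a l * J i (g k) (g l))); last first.
  by near=> i; apply: (near PJ).
apply: cvg_bigsum => k; apply: cvg_bigsum => l.
by apply: cvgM; [exact: cvg_cst | exact: JL].
Unshelve. all: by end_near.
Qed.

(** * Averages over an abelian normal subgroup *)

Section Averages.
Variables (C : numClosedFieldType) (G : groupType) (N : normalClosed G).
Hypothesis abelianN : {in N &, forall m n : G, commute m n}.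
Implicit Types (K : G -> G -> C) (s t : seq G) (x y m n : G).

Definition left_invariant K := {in N, forall n x y, K (n * x)%g (n * y)%g = K x y}.

(** If [K x y = <x, y>], this is [<T x, T y>] for [T = (1 + n) / 2]. *)
Definition avg n K : G -> G -> C := fun x y =>
  4^-1 * (K x y + K (n * x)%g (n * y)%g + K (n * x)%g y + K x (n * y)%g).

Definition avgs s K := foldr avg K s.

Lemma avgs_cat s t K : avgs (s ++ t) K = avgs s (avgs t K).
Proof. exact: foldr_cat. Qed.

Lemma psd_avg n K : psd K -> psd (avg n K).
Proof.
move=> /(psd_comb (fun=> 2^-1) (fun (b : bool) x => if b then n * x else x)%g).
move=> PK I a g; have := PK I a g; congr (_ <= _).
apply: eq_bigr => i _; apply: eq_bigr => j _; congr (_ * _).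
rewrite !big_bool /= geC0_conj ?invr_ge0 // /avg.
by field.
Qed.

(** Left invariance turns the difference into [<T x, T y>] for
    [T = (1 - n) / 2]. *)
Lemma psd_sub_avg n K : n \in N -> left_invariant K -> psd K ->
  psd (fun x y => K x y - avg n K x y).
Proof.
move=> Nn invK.
move=> /(psd_comb (fun b => (if b then 2^-1 else - 2^-1))
  (fun (b : bool) x => if b then n * x else x)%g).
move=> PK I a g; have := PK I a g; congr (_ <= _).
apply: eq_bigr => i _; apply: eq_bigr => j _; congr (_ * _).
rewrite !big_bool /= !rmorphN /= geC0_conj ?invr_ge0 // /avg invK //.
by field.
Qed.

Lemma avgC m n K : m \in N -> n \in N -> avg m (avg n K) = avg n (avg m K).
Proof.
move=> Nm Nn; apply/funext => x; apply/funext => y; rewrite /avg.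
have mn z : (m * (n * z) = n * (m * z))%g by rewrite !mulgA (abelianN Nm Nn).
by rewrite !mn; ring.
Qed.

Lemma avgsC s t K : all [in N] s -> all [in N] t ->
  avgs s (avgs t K) = avgs t (avgs s K).
Proof.
elim: s => //= m s IHs /andP[Nm Ns] Nt; rewrite IHs //.
elim: t Nt {IHs} => //= n t IHt /andP[Nn Nt]; rewrite avgC //.
by rewrite IHt.
Qed.

Lemma left_invariant_avg n K : n \in N -> left_invariant K ->
  left_invariant (avg n K).
Proof.
move=> Nn invK m Nm x y; rewrite /avg.
have mn z : (n * (m * z) = m * (n * z))%g by rewrite !mulgA (abelianN Nm Nn).
by rewrite !mn !invK.
Qed.

Lemma left_invariant_avgs s K : all [in N] s -> left_invariant K ->
  left_invariant (avgs s K).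
Proof.
by elim: s => //= n s IHs /andP[Nn Ns] invK; apply/left_invariant_avg/IHs.
Qed.

Lemma psd_avgs s K : psd K -> psd (avgs s K).
Proof. by elim: s => //= n s IHs PK; apply/psd_avg/IHs. Qed.

Lemma psd_sub_avgs s K : all [in N] s -> left_invariant K -> psd K ->
  psd (fun x y => K x y - avgs s K x y).
Proof.
move=> + invK PK; elim: s => /= [_ I a g|n s IHs /andP[Nn Ns]].
  by rewrite big1 // => i _; rewrite big1 // => j _; rewrite subrr mulr0.
have := psdD (IHs Ns) (psd_sub_avg Nn (left_invariant_avgs Ns invK) (psd_avgs s PK)).
congr psd; apply/funext => x; apply/funext => y; ring.
Qed.

(** The filter on kernels that follows the net of iterated averages of [K],
    ordered by further averaging. *)
Definition avg_tails K : set_system (G -> G -> C) :=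
  [set P | exists2 s, all [in N] s &
           forall t, all [in N] t -> P (avgs t (avgs s K))].

(** Two tails meet because the averages commute. *)
#[export] Instance avg_tails_filter K : ProperFilter (avg_tails K).
Proof.
split; first by case=> s _ /(_ [::] isT).
split.
- by exists [::].
- move=> P Q [s Ns Ps] [t Nt Qt]; exists (s ++ t); first by rewrite all_cat Ns.
  move=> r Nr; split; rewrite avgs_cat.
    by rewrite (avgsC _ Ns Nt) -avgs_cat; apply: Ps; rewrite all_cat Nr.
  by rewrite -avgs_cat; apply: Qt; rewrite all_cat Nr.
- by move=> P Q PQ [s Ns Ps]; exists s => // t Nt; apply/PQ/Ps.
Qed.

Lemma avg_tails_all K (P : set (G -> G -> C)) :
  (forall s, all [in N] s -> P (avgs s K)) -> avg_tails K P.
Proof. by move=> PK; exists [::] => // t Nt; apply: PK. Qed.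

Hypothesis complC : order_complete C.

(** By polarization it is enough that each value of the quadratic form
    converges, and these values decrease along the net. *)
Lemma avg_tails_cvg K x y : psd K -> left_invariant K ->
  exists l : C, J x y @[J --> avg_tails K] --> l.
Proof.
move=> PK invK; pose q d (J : G -> G -> C) :=
  1^* * 1 * J x x + d^* * d * J y y + 1^* * d * J x y + d^* * 1 * J y x.
have qcvg d : exists l : C, q d J @[J --> avg_tails K] --> l.
  pose S := [set avgs s K | s in all [in N]].
  have [] := complC (avg_tails_filter K) (S := S) (u := q d).
  - by exists [::] => // t Nt; exists t.
  - by move=> _ [s Ns <-]; apply/psd_form2/psd_avgs.
  - move=> _ [s Ns <-]; exists s => // t Nt; rewrite -subr_ge0.
    have := psd_form2 1 d x y
      (psd_sub_avgs Nt (left_invariant_avgs Ns invK) (psd_avgs s PK)).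
    by congr (_ <= _); rewrite /q; ring.
  by move=> l cvl; exists l; apply/cvgrPdist_lt.
have [l1 c1] := qcvg 1; have [l2 c2] := qcvg (- 1).
have [l3 c3] := qcvg 'i; have [l4 c4] := qcvg (- 'i).
exists (4^-1 * (l1 - l2 - 'i * l3 + 'i * l4)).
under eq_fun do rewrite (psd_polarization _ x y).
apply: cvgM; first exact: cvg_cst.
apply: cvgD; last by apply: cvgM => //; apply: cvg_cst.
apply: cvgB; last by apply: cvgM => //; apply: cvg_cst.
exact: cvgB.
Qed.

Lemma avg_limit K : psd K -> left_invariant K ->
  exists L : G -> G -> C, forall x y, J x y @[J --> avg_tails K] --> L x y.
Proof.
move=> PK invK.
have /choice[L LP] : forall p : G * G, exists l : C,
    J p.1 p.2 @[J --> avg_tails K] --> l by move=> p; apply: avg_tails_cvg.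
by exists (fun x y => L (x, y)) => x y; apply: (LP (x, y)).
Qed.

End Averages.

(** * The invariant part of a bi-invariant kernel *)

Section InvariantPart.
Variables (C : numClosedFieldType) (G : groupType) (N : normalClosed G).
Hypothesis abelianN : {in N &, forall m n : G, commute m n}.
Hypothesis complC : order_complete C.

Definition conjs (t : G) (s : seq G) := [seq n ^ t | n <- s]%g.

Lemma all_conjs t s : all [in N] s -> all [in N] (conjs t s).
Proof.
by move=> /allP Ns; apply/allP => _ /mapP[n sn ->]; apply/gpred_conj/Ns.
Qed.

Lemma conjsKV t s : conjs t (conjs t^-1 s) = s.
Proof. by apply: mapK => n; rewrite conjgKV. Qed.

(** [n t = t n ^ t]: translating the arguments by [t] conjugates the averaging
    elements. *)
Lemma avgs_translate t s (K : G -> G -> C) x y :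
  avgs s K (t * x)%g (t * y)%g =
  avgs (conjs t s) (fun x y => K (t * x)%g (t * y)%g) x y.
Proof.
elim: s x y => //= n s IHs x y; rewrite /avg -!IHs.
have nt z : (t * (n ^ t * z) = n * (t * z))%g by rewrite conjgE !mulgA mulgV mul1g.
by rewrite !nt.
Qed.

Lemma avgs_translater t s (K : G -> G -> C) x y :
  (forall x y, K (x * t)%g (y * t)%g = K x y) ->
  avgs s K (x * t)%g (y * t)%g = avgs s K x y.
Proof. by move=> Kt; elim: s x y => //= n s IHs x y; rewrite /avg !mulgA !IHs. Qed.

Lemma avgs_const s (K : G -> G -> C) c x y : all [in N] s ->
  {in N &, forall m n, K (m * x)%g (n * y)%g = c} ->
  {in N &, forall m n, avgs s K (m * x)%g (n * y)%g = c}.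
Proof.
move=> + Kc; elim: s => //= m s IHs /andP[Nm Ns] n p Nn Np.
by rewrite /avg !mulgA !IHs ?gpredM //; field.
Qed.

(** [L x y = <p x, p y>] for [p] the projection onto the [N]-invariant vectors,
    obtained as the limit of the net of averages. Conjugation by [t] permutes
    the net, whence the invariance under left translation; averaging once more
    by [n] does not change the limit, so that [(1 - n) / 2] sends [y] to a
    vector of norm zero and [n y], [y] have the same pairings. *)
Theorem invariant_part (K : G -> G -> C) : psd K ->
    (forall t x y, K (t * x)%g (t * y)%g = K x y) ->
    (forall t x y, K (x * t)%g (y * t)%g = K x y) ->
  exists L : G -> G -> C,
  [/\ psd L, psd (fun x y => K x y - L x y),
      (forall t x y, L (t * x)%g (t * y)%g = L x y) /\
      (forall t x y, L (x * t)%g (y * t)%g = L x y),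
      {in N, forall n x y, L x (n * y)%g = L x y} &
      forall x y c, {in N &, forall m n, K (m * x)%g (n * y)%g = c} -> L x y = c].
Proof.
move=> PK Kl Kr.
have invK : left_invariant N K by move=> n _ x y; apply: Kl.
have [L KL] := avg_limit abelianN complC PK invK; exists L.
have FK := avg_tails_filter abelianN K.
have cvgU (u : (G -> G -> C) -> C) (a b : C) :
    u @ avg_tails N K --> a -> u @ avg_tails N K --> b -> a = b.
  exact: (@cvg_unique _ (@norm_hausdorff _ _) (u @ _)).
have PL : psd L.
  apply: (psd_lim FK KL); apply: avg_tails_all => // t _.
  exact: psd_avgs.
have Ll t x y : L (t * x)%g (t * y)%g = L x y.
  apply: cvgU (KL _ _) _.
  apply: cvg_trans (KL x y) => P [s Ns Ps].
  exists (conjs t^-1%g s); first exact: all_conjs.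
  move=> r Nr; rewrite /= -avgs_cat avgs_translate.
  rewrite [conjs t _]map_cat -!/(conjs _ _) conjsKV.
  have -> : (fun x y => K (t * x)%g (t * y)%g) = K.
    by apply/funext => ?; apply/funext => ?.
  by rewrite avgs_cat; apply/Ps/all_conjs.
split=> //.
- apply: (psd_lim FK (J := fun J x y => K x y - J x y)).
    by move=> x y; apply: cvgB => //; apply: cvg_cst.
  apply: avg_tails_all => // t Nt.
  exact: (psd_sub_avgs abelianN).
- split=> // t x y; apply: cvgU (KL _ _) _.
  apply: cvg_trans (KL x y); apply: near_eq_cvg.
  apply: avg_tails_all => // s Ns.
  by rewrite avgs_translater.
- move=> n Nn x y.
  (* Averaging by [n] maps every tail into itself. *)
  have Lavg a b : avg n L a b = L a b.
    have cvavg : avg n J a b @[J --> avg_tails N K] --> avg n L a b.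
      apply: cvgM; first exact: cvg_cst.
      by apply: cvgD => //; apply: cvgD => //; apply: cvgD.
    apply: cvgU cvavg _; apply: cvg_trans (KL a b) => P [s Ns Ps].
    exists s => // t Nt; apply: (Ps (n :: t)); by rewrite /= Nn.
  have := @psd_null _ _ L 1 (- 1) y (n * y)%g x PL.
  rewrite mul1r mulN1r => /(_ _)/subr0_eq -> //.
  have := Lavg y y; rewrite /avg Ll rmorphN !rmorph1 => e.
  transitivity (4 * (L y y - 4^-1 * (L y y + L y y + L (n * y)%g y + L y (n * y)%g))).
    by field.
  by rewrite e subrr mulr0.
- move=> x y c Kc; apply: cvgU (KL x y) _.
  apply: cvg_trans (@cvg_cst _ _ _ _ (avg_tails_filter abelianN K)).
  apply: near_eq_cvg; apply: avg_tails_all => // s Ns.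
  have := avgs_const Ns Kc (gpred1 (s := N)) (gpred1 (s := N)).
  by rewrite !mul1g.
Qed.

End InvariantPart.

(** * Traces and characters *)

Section Traces.
Variables (R : realType) (G : groupType).
Implicit Types (phi psi : G -> R[i]) (x y g h n m t : G).

Definition gram phi : G -> G -> R[i] := fun x y => phi (x^-1 * y)%g.

Lemma positive_definite_psd phi : positive_definite phi <-> psd (gram phi).
Proof.
split=> [P I a g | P n c g]; last exact: P.
have := P #|I| (a \o enum_val) (g \o enum_val); congr (_ <= _).
rewrite [RHS](reindex _ (onW_bij _ (@enum_val_bij I))) /=.
apply: eq_bigr => i _; rewrite [RHS](reindex _ (onW_bij _ (@enum_val_bij I))) /=.
by [].
Qed.

Lemma gramx1 phi x : gram phi x 1%g = phi x^-1%g.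
Proof. by rewrite /gram mulg1. Qed.

Lemma gramxx phi x : gram phi x x = phi 1%g.
Proof. by rewrite /gram mulVg. Qed.

Lemma traceVr phi x : is_trace phi -> phi x^-1%g = (phi x)^*.
Proof.
case=> /positive_definite_psd P _ _; have := psd_hermitian 1%g x P.
by rewrite /gram mulg1 invg1 mul1g.
Qed.

(** The vectors of [1] and [n] are at distance zero. *)
Lemma trace_kerMr phi x n : is_trace phi -> phi n = 1 -> phi (x * n)%g = phi x.
Proof.
move=> tr n1; have [/positive_definite_psd P _ phi1] := tr.
have := @psd_null _ _ _ 1 (- 1) 1%g n x^-1%g P.
rewrite mul1r mulN1r => /(_ _)/subr0_eq; rewrite /gram !invgK !mulg1 => -> //.
rewrite !mulVg invg1 mul1g phi1 traceVr // n1 rmorphN !rmorph1; ring.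
Qed.

(** If [s = psi 1] lies strictly between 0 and 1, then [phi] is the convex
    combination of the traces [psi / s] and [(phi - psi) / (1 - s)]. If [s] is 0
    or 1, then [psi] or [phi - psi] is a positive definite function vanishing at
    1, hence zero. *)
Lemma character_dominated phi psi : is_character phi ->
    psd (gram psi) -> conj_invariant psi ->
    psd (fun x y => gram phi x y - gram psi x y) ->
  forall x, psi x = psi 1%g * phi x.
Proof.
move=> [[/positive_definite_psd Pphi Jphi phi1] ext] Ppsi Jpsi Pdiff x.
have := psd_diag_ge0 1%g Ppsi; have := psd_diag_ge0 1%g Pdiff.
rewrite !gramxx phi1 => le1 ge0.
have [s sE] : exists s : R, psi 1%g = s%:C%C.
  by exists (complex.Re (psi 1%g)); move/ger0_Im: ge0; case: (psi 1%g) => a b /= ->.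
move: ge0; rewrite sE ler0c le_eqVlt => /predU1P[s0|s0].
  have := psd_diag0 x^-1%g Ppsi (x := 1%g).
  by rewrite gramxx gramx1 invgK sE -s0 mul0r; apply.
move: le1; rewrite sE -(rmorph1 (real_complex R)) -rmorphB /= ler0c subr_ge0.
rewrite le_eqVlt => /predU1P[s1|s1].
  have := psd_diag0 x^-1%g Pdiff (x := 1%g).
  rewrite !gramxx !gramx1 invgK sE phi1 s1 subrr mul1r => /(_ erefl)/subr0_eq ->.
  by [].
have sN0 : s%:C%C != 0 :> R[i] by rewrite -[0]/(0%:C%C) (inj_eq (@complexI _)) gt_eqF.
have tN0 : (1 - s)%:C%C != 0 :> R[i].
  by rewrite -[0]/(0%:C%C) (inj_eq (@complexI _)) subr_eq0 gt_eqF.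
have [||||] := ext (fun x => (s^-1)%:C%C * psi x)
  (fun x => ((1 - s)^-1)%:C%C * (phi x - psi x)) s.
- split=> [|g h|]; last by rewrite sE fmorphV mulVf.
    apply/positive_definite_psd; apply: psdZ Ppsi.
    by rewrite ler0c invr_ge0 ltW.
  by rewrite Jpsi.
- split=> [|g h|]; last by
    rewrite phi1 sE fmorphV -(rmorph1 (real_complex R)) -rmorphB mulVf.
    apply/positive_definite_psd; apply: psdZ Pdiff.
    by rewrite ler0c invr_ge0 subr_ge0 ltW.
  by rewrite Jpsi Jphi.
- by rewrite s0.
- by move=> g; rewrite !fmorphV !mulrA !divff // !mul1r addrC subrK.
move=> /(_ x) <- _; by rewrite fmorphV mulrA divff // mul1r.
Qed.

(** The [N]-invariant part of [phi] is a multiple of [phi]; by the last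
    clause of [invariant_part] both take the same non-zero value at [g], so they
    are equal. *)
Theorem character_periods (N : normalClosed G) phi g :
    {in N &, forall m n : G, commute m n} -> is_character phi -> phi g != 0 ->
    {in N, forall n, phi (g * n)%g = phi g} ->
  {in N, forall n, phi n = 1}.
Proof.
move=> abN char_phi phig0 per n Nn.
have [[/positive_definite_psd Pphi Jphi phi1] _] := char_phi.
have [||L [PL PD [Ll Lr] Ln Lc]] :=
  invariant_part abN (@order_complete_complex R) Pphi.
- by move=> t x y; rewrite /gram invgM -!mulgA mulKg.
- move=> t x y; rewrite /gram -[RHS](Jphi t) conjgE invgM !mulgA.
  by [].
have LE : L = gram (L 1%g).
  by apply/funext => x; apply/funext => y; rewrite /gram -(Ll x 1%g) mulg1 mulVKg.
have dom := @character_dominated _ (L 1%g) char_phi.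
rewrite -LE in dom; have {}dom := dom PL _ PD.
have {}dom x : L 1%g x = L 1%g 1%g * phi x.
  apply: dom => t h.
  by rewrite -[RHS](Lr t) mul1g -[RHS](Ll t^-1%g) mulVg conjgE mulgA.
have Lg : L 1%g g = phi g.
  apply: Lc => m p Nm Np; rewrite /gram mulg1 -(per (m^-1 * p)%g) ?gpredM ?gpredV //.
  by rewrite -[RHS](Jphi g) conjgE !mulgA mulVg mul1g.
have L1 : L 1%g 1%g = 1.
  by apply: (mulIf phig0); rewrite -dom mul1r.
by rewrite -[LHS]mul1r -{1}L1 -dom -[n]mulg1 Ln.
Qed.

End Traces.

Lemma normal_subgroup_exists (G : groupType) (P : G -> Prop) :
    P 1%g -> (forall x y, P x -> P y -> P (x * y)%g) ->
    (forall x, P x -> P x^-1%g) -> (forall x y, P x -> P (x ^ y)%g) ->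
  exists N : normalClosed G, forall x, x \in N <-> P x.
Proof.
move=> P1 PM PV PJ; pose S : {pred G} := fun x => `[< P x >].
have SP x : reflect (P x) (x \in S) := asboolP _.
have S1 : 1%g \in S by apply/SP.
have SM : mulg_closed S by move=> x y /SP Px /SP Py; apply/SP/PM.
have SV : invg_closed S by move=> x /SP Px; apply/SP/PV.
have SJ x y : x \in S -> (x ^ y)%g \in S by move=> /SP Px; apply/SP/PJ.
pose N : normalClosed G := HB.pack S (isMulClosed.Build G S SM)
  (isMul1Closed.Build G S S1) (isInvClosed.Build G S SV)
  (isConjClosed.Build G S SJ).
by exists N => x; split=> /SP.
Qed.

Section CharacterKernel.
Variables (R : realType) (G : groupType) (phi : G -> R[i]).
Implicit Types (x y g h k a n m t : G).
Hypothesis tr : is_trace phi.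
Let phiJ : conj_invariant phi. Proof. by case: tr. Qed.
Let kerMr := fun x n => @trace_kerMr R G phi x n tr.

Lemma trace_kerV n : phi n = 1 -> phi n^-1%g = 1.
Proof. by move=> n1; rewrite traceVr // n1 rmorph1. Qed.

(** Commutator identities express each closure property through conjugates of
    commutators with [S], up to factors in the kernel. *)
Lemma centraliser_mod_ker (S : G -> Prop) : (forall x t, S x -> S (x ^ t)%g) ->
  exists N : normalClosed G,
    forall x, x \in N <-> forall y, S y -> phi [~ x, y]%g = 1.
Proof.
move=> SJ; apply: normal_subgroup_exists.
- by move=> y _; rewrite comm1g; case: tr.
- move=> x y Cx Cy z Sz.
  have -> : [~ x * y, z]%g = ([~ x, z] ^ y * [~ y, z])%g.
    by rewrite !commgEl !conjgE !gnorm.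
  by rewrite kerMr ?phiJ ?Cx ?Cy.
- move=> x Cx y Sy.
  have -> : [~ x^-1, y]%g = ([~ x, y]^-1 ^ x^-1)%g.
    by rewrite !commgEl !conjgE !gnorm.
  by rewrite phiJ trace_kerV ?Cx.
- move=> x t Cx y Sy; have -> : [~ x ^ t, y]%g = ([~ x, y ^ t^-1] ^ t)%g.
    by rewrite conjRg conjgKV.
  by rewrite phiJ Cx //; apply: SJ.
Qed.

End CharacterKernel.

(** * Characters of metabelian groups *)

Section MetabelianCharacter.
Variables (R : realType) (G : groupType) (phi : G -> R[i]).
Implicit Types (x y g h k a n m t : G).
Hypotheses (metabG : metabelian G) (char_phi : is_character phi).
Let tr : is_trace phi. Proof. by case: char_phi. Qed.
Let phiJ : conj_invariant phi. Proof. by case: tr. Qed.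

(** Asking for invariance on all of [g A], with [A] the derived subgroup, makes
    the set of periods normal in [G]: conjugation moves [g] inside [g A]. *)
Definition derived_period g n :=
  n \in @derived G /\ {in @derived G, forall m, phi (g * m * n)%g = phi (g * m)%g}.

Lemma commg_derived x y : [~ x, y]%g \in @derived G.
Proof. by apply/derivedP => S; apply. Qed.

Lemma derived_period_ker g n : phi g != 0 -> derived_period g n -> phi n = 1.
Proof.
move=> phig0.
have [|m p [Dm Pm] [Dp Pp]|m [Dm Pm]|m t [Dm Pm]|N NP] :=
  normal_subgroup_exists (P := derived_period g).
- by split=> [|m _]; rewrite ?gpred1 ?mulg1.
- split=> [|q Dq]; first exact: gpredM.
  by rewrite mulgA -(mulgA g) Pp ?gpredM // mulgA Pm.
- split=> [|q Dq]; first by rewrite gpredV.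
  by rewrite -(mulgA g) -[LHS]Pm ?gpredM ?gpredV // -!mulgA mulVg mulg1.
- split=> [|q Dq]; first exact: gpred_conj.
  have gJ : (g ^ t^-1 = g * [~ g, t^-1])%g by rewrite commgEl mulVKg.
  rewrite -(phiJ t^-1%g) 2!conjMg conjgK gJ -(mulgA g) Pm; last first.
    by apply: gpredM; [exact: commg_derived | exact: gpred_conj].
  by rewrite mulgA -gJ -conjMg phiJ.
move=> /NP Nn; apply: (@character_periods R G N phi g) Nn => //.
  by move=> m p /NP[Dm _] /NP[Dp _]; apply: metabG.
by move=> m /NP[_ /(_ _ (gpred1 (s := @derived G)))]; rewrite mulg1.
Qed.

(** For [m] in [A], [g m [g, a] = (g m) ^ a] because [A] is abelian, so [[g, a]]
    is a period of [phi] at [g]. *)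
Lemma commg_derived_ker g a : phi g != 0 -> a \in @derived G ->
  phi [~ g, a]%g = 1.
Proof.
move=> phig0 Da; apply: (derived_period_ker phig0); split=> [|m Dm].
  exact: commg_derived.
rewrite -[RHS](phiJ a) conjMg -mulgA (metabG Dm (commg_derived g a)).
by rewrite commgEl mulgA mulVKg [(m ^ a)%g]conjgE (metabG Dm Da) mulKg.
Qed.

(** [g m [g, k] = g ^ k m] is conjugate to [g m ^ k^-1], and [m ^ k^-1] agrees
    with [m] modulo the kernel by [commg_derived_ker] applied to [k]; so [[g, k]]
    is again a period of [phi] at [g]. *)
Lemma support_commg_ker g k : phi g != 0 -> phi k != 0 -> phi [~ g, k]%g = 1.
Proof.
move=> phig0 phik0; apply: (derived_period_ker phig0); split=> [|m Dm].
  exact: commg_derived.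
have mJ : (m ^ k^-1 = m * [~ k, m] ^ k^-1)%g.
  by rewrite commgEl !conjgE !gnorm.
rewrite -mulgA (metabG Dm (commg_derived g k)) commgEl mulgA mulVKg.
rewrite -(phiJ k^-1%g) conjMg conjgK mJ mulgA.
by apply: trace_kerMr tr _; rewrite phiJ commg_derived_ker.
Qed.

(** [H] is the bicommutant of the support modulo the kernel. It contains the
    support, and it is abelian modulo the kernel because the support lies in its
    own centraliser [Z], so that [H], the centraliser of [Z], lies in [Z]. *)
Lemma abelian_mod_ker_support : exists H : normalClosed G,
  {in H &, forall x y, phi [~ x, y]%g = 1} /\
  (forall x, x \notin H -> phi x = 0).
Proof.
have [|Z ZP] := centraliser_mod_ker tr (S := fun x => phi x != 0).
  by move=> x t; rewrite phiJ.
have [|H HP] := centraliser_mod_ker tr (S := fun x => x \in Z).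
  by move=> x t; apply: gpred_conj.
have suppZ x : phi x != 0 -> x \in Z.
  by move=> phix; apply/ZP => y; apply: support_commg_ker.
have HZ x : x \in H -> x \in Z.
  by move=> /HP Hx; apply/ZP => y /suppZ; apply: Hx.
exists H; split=> [x y /HP Hx /HZ|x]; first exact: Hx.
apply: contraNeq => phix; apply/HP => y /ZP/(_ x phix) yx.
by rewrite -invgR trace_kerV.
Qed.

End MetabelianCharacter.

(** * Traces supported on a normal subgroup *)

Section InductionFromNormal.
Variables (R : realType) (G : groupType) (H : normalClosed G) (phi : G -> R[i]).
Hypotheses (tr : is_trace phi) (phi_out : forall x, x \notin H -> phi x = 0).
Let phiJ : conj_invariant phi. Proof. by case: tr. Qed.

Lemma zero_ext_restr : zero_ext (phi \o @sgval G H) = phi.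
Proof.
apply/funext => x; have [Hx|Hx] := boolP (x \in H).
  by rewrite -[x]/(val (SubgroupElt Hx)) zero_ext_val.
by rewrite zero_ext_out // phi_out.
Qed.

Lemma stabiliser_restr x : x \in stabiliser (phi \o @sgval G H).
Proof.
apply/stabiliserP; split=> y; last by rewrite zero_ext_restr.
apply/idP/idP => [Hyx|]; last exact: gpred_conj.
by rewrite -[y](conjgK x); apply: gpred_conj.
Qed.

Lemma lcosets_stabiliser :
  [set: lcosets (stabiliser (phi \o @sgval G H))] =
  [set \pi_(lcosets (stabiliser (phi \o @sgval G H))) 1%g].
Proof.
apply/seteqP; split=> // a _ /=; rewrite -[a]reprK.
by apply/pi_lcosetP/stabiliser_restr.
Qed.

Lemma almost_invariant_restr : almost_invariant (phi \o @sgval G H).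
Proof.
by rewrite /almost_invariant /finite_index lcosets_stabiliser; apply: finite_set1.
Qed.

Lemma Ind_restr : Ind (phi \o @sgval G H) = phi.
Proof.
apply/funext => x; rewrite /Ind /subgroup_index lcosets_stabiliser.
rewrite fset_set1 cardfs1 invr1 mul1r fsbig_set1 zero_ext_restr.
exact: phiJ.
Qed.

(** The kernel of [phi] contains the derived subgroup of [H], so [phi] descends
    to the abelianization of [H]; it is conjugation invariant on [G], so its
    stabiliser is [G] and the induction has a single term. *)
Lemma induced_from_abelianization_restr :
  {in H &, forall x y, phi [~ x, y]%g = 1} -> induced_from_abelianization H phi.
Proof.
move=> abH; pose HT := subgroup_type H.
have derived_ker (d : HT) : d \in @derived HT -> phi (val d) = 1.
  have [|x y|x|x y|N NP] := @normal_subgroup_exists HT (fun x => phi (val x) = 1).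
  - by case: tr.
  - by move=> phix phiy; rewrite /= trace_kerMr.
  - exact: trace_kerV.
  - by move=> phix; rewrite conjgE /= -conjgE phiJ.
  move=> /derivedP/(_ N) dN; apply/NP/dN => a b; apply/NP.
  exact: (abH _ _ (sgvalP a) (sgvalP b)).
pose chi (q : quotient_group (@derived HT)) := phi (val (repr q)).
have chiE (k : HT) : chi (\pi k) = phi (val k).
  have [n /derived_ker n1 kn] := repr_lcoset (@derived HT) k.
  by rewrite /chi kn /= trace_kerMr.
exists chi => /=.
have -> : (fun k : HT => chi (\pi_(quotient_group (@derived HT)) k)) =
    phi \o @sgval G H.
  by apply/funext => k; apply: chiE.
split; [|exact: almost_invariant_restr|by rewrite Ind_restr].
have [P _ phi1] := tr; split.
- move=> n c g; have := P n c (fun i => val (repr (g i))); congr (_ <= _).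
  apply: eq_bigr => i _; apply: eq_bigr => j _; congr (_ * _).
  (* Computing in the quotient means moving [\pi] out of the group operations. *)
  rewrite -{2}[g i]reprK -{2}[g j]reprK.
  rewrite -[((\pi_(quotient_group (@derived HT)) (repr (g i)))^-1)%g]/(quot_inv _) quot_piV.
  rewrite -[X in chi X]/(quot_mul _ _) quot_piM chiE.
  by [].
- move=> a b; rewrite -[a]reprK -[b]reprK.
  rewrite conjgE [RHS]chiE.
  rewrite -[((\pi_(quotient_group (@derived HT)) (repr a))^-1)%g]/(quot_inv _) quot_piV.
  rewrite -[X in chi X]/(quot_mul _ (quot_mul _ _)) !quot_piM chiE /=.
  by rewrite -conjgE phiJ.
- by rewrite chiE.
Qed.

End InductionFromNormal.

Theorem theorem2 (R : realType) (G : groupType)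
    (countableG : countable [set: G]) (metabelianG : metabelian G)
    (phi : G -> R[i]) (char_phi : is_character phi) :
  exists H : normalClosed G, induced_from_abelianization H phi.
Proof.
have [H [abH outH]] := abelian_mod_ker_support metabelianG char_phi.
exists H; apply: induced_from_abelianization_restr => //.
by case: char_phi.
Qed.
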